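(* Let $u,v\in\mathfrak{S}_n$. Then $\gamma_u\leq\gamma_v$ with respect to the permuton Bruhat order if and only if $u\leq v$ with respect to the Bruhat order on $\mathfrak{S}_n$.
   Context: A permuton is a measure $\mu$ on the Borel sets of $[0,1]\times[0,1]$ with $\mu([0,k]\times[0,1])=k=\mu([0,1]\times[0,k])$ for all $k\in[0,1]$. Permuton Bruhat order: $\mu\geq\nu$ if $\mu([0,a]\times[0,b])\leq\nu([0,a]\times[0,b])$ for all $0<a,b<1$. For $w\in\mathfrak{S}_n$ (permutations of $\{1,\dots,n\}$), the permuton $\gamma_w$ is obtained by dividing the unit square into $n$ equal columns and $n$ equal rows and putting a uniform measure of total weight $1/n$ on each of the squares $[\frac{i-1}n,\frac in]\times[\frac{w(i)-1}n,\frac{w(i)}n]$, $1\le i\le n$. Bruhat order on $\mathfrak{S}_n$ is the usual one; equivalently, $u\le v$ if and only if $u[i,j]\le v[i,j]$ for all $1\le i,j\le n$, where $u[i,j]=|\{a\in\{1,\dots,i\}:u(a)>j\}|$. *)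

(* Defs.v *)
From HB Require Import structures.
From mathcomp Require Import all_boot all_order all_algebra all_fingroup.
From mathcomp Require Import all_classical all_reals all_analysis.
Import Order.TTheory GRing.Theory Num.Theory.
Import numFieldNormedType.Exports.

Set Implicit Arguments.
Unset Strict Implicit.
Unset Printing Implicit Defensive.

Local Open Scope classical_set_scope.
Local Open Scope ring_scope.

Section BruhatOrder.
Variable n : nat.
Implicit Types u v : 'S_n.

(* The Coxeter length of a permutation is its number of inversions. *)
Definition perm_length u : nat :=
  #|[set p : 'I_n * 'I_n | (p.1 < p.2)%N && (u p.2 < u p.1)%N]%SET|.

(* Products of permutations apply the left factor first, so [tperm i j * u]
   is u composed with the transposition (i j) acting on positions. *)
Definition bruhat_step : rel 'S_n := fun u v =>
  [exists i : 'I_n, exists j : 'I_n,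
    [&& i != j, v == (tperm i j * u)%g & (perm_length u < perm_length v)%N]].

Definition bruhat_le u v : bool := connect bruhat_step u v.

End BruhatOrder.

Section Permutons.
Variable R : realType.

Local Notation plane := (measurableTypeR R * measurableTypeR R)%type.

(* A measure on the Borel sets of the unit square is encoded as a Borel measure
   on the plane that vanishes outside the unit square. *)
Definition is_permuton (mu : set plane -> \bar R) : Prop :=
  mu (~` (`[0, 1] `*` `[0, 1])) = 0%E /\
  forall k : R, 0 <= k <= 1 ->
    mu (`[0, k] `*` `[0, 1]) = k%:E /\ mu (`[0, 1] `*` `[0, k]) = k%:E.

Record permuton := Permuton {
  permuton_measure :> {measure set plane -> \bar R};
  permutonP : is_permuton permuton_measure }.

(* Larger permutons give smaller mass to the boxes at the origin. *)
Definition permuton_le (nu mu : permuton) : Prop :=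
  forall a b : R, 0 < a < 1 -> 0 < b < 1 ->
    (mu (`[0%R, a] `*` `[0%R, b]) <= nu (`[0%R, a] `*` `[0%R, b]))%E.

Section PermutationPermuton.
Variable n : nat.

(* Indices start at 0: [grid_itv i] is the i.+1-st interval of the subdivision
   of [0, 1] into n intervals of length 1/n. *)
Definition grid_itv (i : 'I_n) : set (measurableTypeR R) :=
  `[i%:R / n%:R, i.+1%:R / n%:R].

Definition grid_square (i j : 'I_n) : set plane := grid_itv i `*` grid_itv j.

(* A square of the grid has area 1/n^2, so the uniform measure of total weight
   1/n on it is n times the restriction of the Lebesgue measure. *)
Definition gamma_measure (w : 'S_n) (A : set plane) : \bar R :=
  (\sum_(i < n) n%:R%:E *
    (lebesgue_measure \x lebesgue_measure) (A `&` grid_square i (w i)))%E.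

Lemma measurable_grid_itv i : measurable (grid_itv i).
Proof. exact: measurable_itv. Qed.

Lemma measurable_grid_square i j : measurable (grid_square i j).
Proof. by apply: measurableX; exact: measurable_grid_itv. Qed.

Section GammaMeasure.
Variable w : 'S_n.

Let restr i : {measure set plane -> \bar R} :=
  mscale (NngNum (ler0n R n))
    (mrestr (lebesgue_measure \x lebesgue_measure)%E
       (measurable_grid_square i (w i))).

Let gammaE A : gamma_measure w A = (\sum_(i < n) restr i A)%E.
Proof. by []. Qed.

Let gamma0 : gamma_measure w set0 = 0%E.
Proof. by rewrite gammaE big1. Qed.

Let gamma_ge0 A : (0 <= gamma_measure w A)%E.
Proof. by rewrite gammaE; apply: sume_ge0. Qed.

Let gamma_sigma_additive : semi_sigma_additive (gamma_measure w).
Proof.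
move=> F mF tF mUF; rewrite [X in _ --> X](_ : _ =
    lim ((fun m => \sum_(0 <= i < m) gamma_measure w (F i))%E @ \oo)).
  by apply: is_cvg_ereal_nneg_natsum => k _; exact: gamma_ge0.
rewrite [RHS](@nneseries_sum _ _ _ R (fun i k => restr i (F k)))//.
by rewrite gammaE; apply: eq_bigr => i _; exact: measure_semi_bigcup.
Qed.

HB.instance Definition _ := isMeasure.Build _ _ _ (gamma_measure w)
  gamma0 gamma_ge0 gamma_sigma_additive.

End GammaMeasure.

Lemma lebesgue_grid_itvI (i : 'I_n) (k : R) : 0 <= k ->
  lebesgue_measure (`[0, k] `&` grid_itv i) =
  (Num.min (i.+1%:R / n%:R) k - Num.min (i%:R / n%:R) k)%:E.
Proof.
move=> k0; set a := _ / _; set b := _ / _.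
have a0 : 0 <= b by rewrite divr_ge0.
have ab : b <= a by rewrite ler_wpM2r ?invr_ge0 ?ler_nat.
have -> : `[0, k] `&` grid_itv i = `[b, Num.min a k]%classic.
  rewrite /grid_itv; apply/seteqP; split=> x /=; rewrite !in_itv/= le_min.
    by move=> [/andP[_ ->] /andP[-> ->]].
  by move=> /and3P[bx -> ->]; rewrite bx (le_trans a0 bx).
rewrite lebesgue_measure_itv/= lte_fin -EFinD.
case: (lerP a k) => ak; case: (lerP b k) => bk.
- rewrite lt_neqAle ab andbT; case: eqVneq => //= ->; by rewrite subrr.
- by move: (lt_le_trans bk (le_trans ab ak)); rewrite ltxx.
- rewrite lt_neqAle bk andbT; case: eqVneq => //= ->; by rewrite subrr.
- by rewrite ltNge (ltW bk)/= subrr.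
Qed.

Hypothesis n_gt0 : (0 < n)%N.

Lemma grid_itv_sub01 (i : 'I_n) : grid_itv i `<=` `[0, 1].
Proof.
rewrite /grid_itv => x /=; rewrite !in_itv/= => /andP[ix xi].
rewrite (le_trans _ ix) ?divr_ge0//= (le_trans xi)//.
by rewrite ler_pdivrMr ?ltr0n// mul1r ler_nat.
Qed.

Lemma lebesgue_grid_itv (i : 'I_n) : lebesgue_measure (grid_itv i) = (n%:R^-1)%:E.
Proof.
rewrite /grid_itv lebesgue_measure_itv/= lte_fin ltr_pM2r ?invr_gt0 ?ltr0n// ltr_nat ltnSn.
by rewrite -EFinD -mulrBl -natrB ?leqnSn// subSnn mul1r.
Qed.

Lemma sum_lebesgue_grid_itvI (k : R) : 0 <= k <= 1 ->
  (\sum_(i < n) lebesgue_measure (`[0%R, k] `&` grid_itv i) = k%:E)%E.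
Proof.
move=> /andP[k0 k1].
under eq_bigr do rewrite lebesgue_grid_itvI//.
rewrite sumEFin -(big_mkord xpredT (fun i : nat =>
  Num.min (i.+1%:R / n%:R) k - Num.min (i%:R / n%:R) k)).
rewrite telescope_sumr// mul0r divff ?pnatr_eq0 -?lt0n//.
by rewrite (min_idPr k1) (min_idPl k0) subr0.
Qed.

Lemma gamma_is_permuton (w : 'S_n) : is_permuton (gamma_measure w).
Proof.
have nK : (n%:R * n%:R^-1 = 1 :> R) by rewrite divff// pnatr_eq0 -lt0n.
have mI (k : R) (i : 'I_n) :
    measurable (`[0, k] `&` grid_itv i : set (measurableTypeR R)).
  by apply: measurableI; [exact: measurable_itv|exact: measurable_grid_itv].
split=> [|k k01].
  rewrite /gamma_measure big1// => i _.
  rewrite [X in product_measure1 _ _ X](_ : _ = set0) ?measure0 ?mule0//.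
  rewrite -subset0 => -[x y] [/= h [xi yj]]; apply: h; split => /=.
    exact: (grid_itv_sub01 xi).
  exact: (grid_itv_sub01 yj).
rewrite /gamma_measure; split.
  rewrite -[RHS]sum_lebesgue_grid_itvI//; apply: eq_bigr => i _.
  rewrite /grid_square -setXI product_measure1E//.
  rewrite (setIidr (@grid_itv_sub01 (w i)))/= lebesgue_grid_itv.
  by rewrite muleCA -EFinM nK mule1.
rewrite -[RHS]sum_lebesgue_grid_itvI// [RHS](reindex_inj (@perm_inj _ w))/=.
apply: eq_bigr => i _.
rewrite /grid_square -setXI product_measure1E//.
rewrite (setIidr (@grid_itv_sub01 i))/= lebesgue_grid_itv.
by rewrite muleA -EFinM nK mul1e.
Qed.

Definition gamma (w : 'S_n) : permuton := Permuton (gamma_is_permuton w).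

End PermutationPermuton.
End Permutons.

Arguments gamma R {n} n_gt0 w.

(* Main.v *)
Require Import Defs.
From mathcomp Require Import all_boot all_order all_algebra all_fingroup.
From mathcomp Require Import all_classical all_reals all_analysis.
From mathcomp Require Import zify ring lra.
Import Order.TTheory GRing.Theory Num.Theory.

(** Both orders are controlled by the same integers: for a permutation w, let
    [box_count w p q] be the number of points of the graph of w in the lower
    left p by q box of the grid.

    On the permuton side, the box with corner (p/n, q/n) has gamma_w-mass
    [box_count w p q / n], so that the permuton order implies the comparison of
    all box counts. Conversely, the mass of an arbitrary box with corner (a, b)
    is n times the sum over i of [strip i a * strip (w i) b], where [strip i a]
    is the length of the part of the i-th grid interval to the left of a. This
    length is nonincreasing in i and vanishes at i = n, so it is a combination
    with nonnegative coefficients of indicators of initial segments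
    ([strip_layers]). Hence the mass of the box is a combination of box counts
    whose nonnegative coefficients depend on a and b and not on w
    ([sum_strip_box_count]), and grid boxes decide the permuton order
    ([permuton_le_boxP]).

    On the Bruhat side, this is the classical rank criterion
    ([bruhat_le_boxP]). Swapping the values at two positions i < j with
    u i < u j takes one point away from the boxes whose corner lies in a
    certain rectangle and changes no other count ([box_count_tperm]); this
    proves one implication. For the other one, suppose that the box counts of
    v are at most those of u, and that u and v first differ at i. Then u i < v i,
    and swapping i with the first later position j such that u i < u j <= v i
    goes up from u while remaining below v ([box_le_lift]). As the length
    increases and is bounded, v is reached after finitely many swaps. *)

Set Implicit Arguments.
Unset Strict Implicit.
Unset Printing Implicit Defensive.

(** * Box counts and the Bruhat order *)

Section BoxCount.
Variable n : nat.
Implicit Types (u v w : 'S_n) (i j k : 'I_n) (p q : nat).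

Definition box_count w p q : nat := \sum_(k < n) ((k < p) && (w k < q)).

Definition box_le u v : Prop := forall p q, box_count v p q <= box_count u p q.

Lemma box_count0l w q : box_count w 0 q = 0.
Proof. by rewrite /box_count big1. Qed.

Lemma box_count0r w p : box_count w p 0 = 0.
Proof. by rewrite /box_count big1// => k _; rewrite ltn0 andbF. Qed.

Lemma box_count_fulll w p q : n <= p -> box_count w p q = \sum_(k < n) (k < q).
Proof.
move=> np; rewrite [RHS](reindex_inj (@perm_inj _ w))/=.
by apply: eq_bigr => k _; rewrite (leq_trans (ltn_ord k) np).
Qed.

Lemma box_count_fullr w p q : n <= q -> box_count w p q = \sum_(k < n) (k < p).
Proof.
move=> nq; apply: eq_bigr => k _.
by rewrite (leq_trans (ltn_ord (w k)) nq) andbT.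
Qed.

(** The points (i, u i) and (j, u j) become (i, u j) and (j, u i). A box that
    contains the first of these four points and none of the other three loses a
    point; in every other box the changes balance. *)
Lemma box_count_tperm u i j p q : i < j -> u i < u j ->
  box_count (tperm i j * u)%g p q + ((i < p <= j) && (u i < q <= u j)) =
  box_count u p q.
Proof.
move=> ij uij; have ji : j != i by rewrite -val_eqE /=; lia.
rewrite /box_count (bigD1 i)//= (bigD1 j)//=.
rewrite [RHS](bigD1 i)//= [in RHS](bigD1 j)//= !permM tpermL tpermR.
rewrite (eq_bigr (fun k : 'I_n => ((k < p) && (u k < q)) : nat)); last first.
  by move=> k /andP[ki kj]; rewrite permM tpermD// eq_sym.
lia.
Qed.

(** The map phi below applies the transposition to both ends of an inversion
    of u as long as this keeps them in increasing order, and does nothing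
    otherwise. It embeds the inversions of u into those of tperm i j * u, and
    misses the new inversion (i, j). *)
Lemma perm_length_tperm u i j : i < j -> u i < u j ->
  perm_length u < perm_length (tperm i j * u)%g.
Proof.
move=> ij uij; set t := tperm i j.
pose phi (p : 'I_n * 'I_n) := if t p.1 < t p.2 then (t p.1, t p.2) else p.
rewrite /perm_length.
set Iu := [set p | _ ]%SET; set Iv := [set p | _ ]%SET.
have phi_inj : {in Iu &, injective phi}.
  move=> [a b] [c d]; rewrite !inE /= => /andP[ab _] /andP[cd _].
  rewrite /phi /=; case: ifPn => tab; case: ifPn => tcd [].
  - by move=> /perm_inj -> /perm_inj ->.
  - by move=> ac bd; move: tcd; rewrite -ac -bd !tpermK ab.
  - by move=> ac bd; move: tab; rewrite ac bd !tpermK cd.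
  - by move=> -> ->.
rewrite -(card_in_imset phi_inj); apply: proper_card.
apply/properP; split.
  apply/fintype.subsetP => _ /imsetP[[a b] + ->]; rewrite !inE /= => /andP[ab uba].
  rewrite /phi /=; case: ifPn => /= tab; first by rewrite tab !permM !tpermK.
  rewrite ab !permM /= -/t; move: ab tab uba; rewrite /t.
  case: tpermP => [->|->|_ _]; case: tpermP => [->|->|_ _] /=; lia.
exists (i, j); first by rewrite inE /= ij !permM tpermL tpermR.
apply/negP => /imsetP[[a b]]; rewrite inE /= => /andP[ab uba].
rewrite /phi /=; case: ifPn => tab [] ai bj.
  by move: ab; rewrite -(tpermK i j a) -(tpermK i j b) -/t -ai -bj tpermL tpermR; lia.
by move: uba; rewrite -ai -bj; lia.
Qed.

(** The definition of a step compares lengths; by [perm_length_tperm], used for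
    u or for its image under the transposition, this amounts to comparing the
    two values that are swapped. *)
Lemma bruhat_stepP u v : reflect
  (exists i j, [/\ i < j, u i < u j & v = tperm i j * u]%g) (bruhat_step u v).
Proof.
apply: (iffP idP).
  move=> /existsP[i /existsP[j /and3P[ij /eqP -> luv]]].
  wlog lt_ij : i j ij luv / i < j.
    move=> H; have [/H|ji|/val_inj e] := ltngtP i j; first exact.
      by rewrite tpermC; apply: H; rewrite // 1?eq_sym// tpermC.
    by rewrite e eqxx in ij.
  exists i, j; split=> //; rewrite ltnNge leq_eqVlt; apply/negP => /orP[/eqP|] uji.
    by move/val_inj/perm_inj: uji ij => ->; rewrite eqxx.
  have := @perm_length_tperm (tperm i j * u)%g i j lt_ij.
  rewrite mulgA tperm2 mul1g !permM tpermL tpermR => /(_ uji) ?; lia.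
move=> [i [j [ij uij ->]]]; apply/existsP; exists i; apply/existsP; exists j.
rewrite eqxx perm_length_tperm// -val_eqE /=; lia.
Qed.

Lemma bruhat_le_box_le u v : bruhat_le u v -> box_le u v.
Proof.
move=> /connectP[s]; elim: s u => [u _ -> //|w s IH u] /=.
move=> /andP[/bruhat_stepP[i [j [ij uij ->]]] /IH{}IH] /IH le_wv p q.
apply: leq_trans (le_wv p q) _.
by rewrite -(box_count_tperm p q ij uij) leq_addr.
Qed.

Lemma first_difference u v : u <> v ->
  exists2 i, u i != v i & forall k, k < i -> u k = v k.
Proof.
move=> uv; have [k0 k0P] : exists k, u k != v k.
  apply/existsP; apply: contra_notT uv => /existsPn uv; apply/permP => k.
  by apply/eqP; rewrite -[_ == _]negbK uv.
case: (@arg_minnP _ k0 (fun k => u k != v k) (fun k => k : nat) k0P) => i iP imin.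
exists i => // k ki; apply/eqP; apply: contraLR ki => /imin; lia.
Qed.

(** In the first i.+1 columns, the boxes of height (v i).+1 count the same
    points for u and v except in column i, where v always contributes. *)
Lemma box_le_first_lt u v i : box_le u v -> u i != v i ->
  (forall k, k < i -> u k = v k) -> u i < v i.
Proof.
move=> le_uv ne_i eq_lt; move: (le_uv i.+1 (v i).+1).
rewrite /box_count (bigD1 i)//= [X in _ <= X](bigD1 i)//= !ltnS !leqnn /=.
rewrite (eq_bigr (fun k : 'I_n => ((k < i.+1) && (u k < (v i).+1)) : nat)); last first.
  move=> k ki; case: (ltnP k i.+1) => //=; rewrite ltnS => le_ki.
  by rewrite eq_lt// ltn_neqAle val_eqE ki.
have : u i <> v i :> nat by move/val_inj => e; rewrite e eqxx in ne_i.
case: (ltngtP (u i) (v i)) => //= *; lia.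
Qed.

(** The rectangle of boxes that lose a point has its corners in
    i < p <= j and u i < q <= u j, so the inequality for v must be strict there.
    By the choice of j, no column strictly between i and j has a value of u in
    the interval from u i (excluded) to v i (included). Hence, when the height of
    such a box is raised from q to (v i).+1, the count of u does not increase
    outside of the columns before i, where u and v agree, whereas that of v
    gains the point of column i. Since the inequality holds for the
    higher box, it is strict for the lower one. *)
Lemma box_le_lift u v : box_le u v -> u <> v ->
  exists2 w, bruhat_step u w & box_le w v.
Proof.
move=> le_uv /first_difference[i ne_i eq_lt].
have lt_i := box_le_first_lt le_uv ne_i eq_lt.
pose P k := [&& i < k, u i < u k & u k <= v i].
have [j0 Pj0] : exists k, P k.
  (* The value v i is taken by u at a position that can only be after i. *)
  exists (u^-1 (v i))%g; rewrite /P permKV lt_i leqnn !andbT ltnNge.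
  rewrite leq_eqVlt; apply/negP => /orP[/eqP/val_inj e|e].
    by move: lt_i; rewrite -{1}e permKV ltnn.
  have := eq_lt _ e; rewrite permKV => /perm_inj e'.
  by move: e; rewrite -e' ltnn.
case: (@arg_minnP _ j0 P (fun k => k : nat) Pj0) => j /and3P[ij uij uj_vi] jmin.
exists (tperm i j * u)%g; first by apply/bruhat_stepP; exists i, j.
move=> p q; have := box_count_tperm p q ij uij.
case: andP => [[/andP[ip pj] /andP[uiq quj]]|_]; last first.
  by rewrite addn0 => ->; exact: le_uv.
suff lt_box : box_count v p q < box_count u p q.
  by rewrite addn1 => e; rewrite -ltnS e.
(* This holds column by column, the summand 1 being used in column i. *)
have : box_count v p q + 1 + box_count u p (v i).+1 <=
       box_count u p q + box_count v p (v i).+1.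
  have <- : \sum_(k < n) (k == i) = 1%N by rewrite (bigD1 i)//= eqxx big1// => k /negbTE ->.
  rewrite /box_count -!big_split /=; apply: leq_sum => k _.
  case: (ltngtP k i) => [ki|ik|/val_inj ->].
  - have -> : (k == i) = false by rewrite -val_eqE /=; lia.
    by rewrite eq_lt// addn0.
  - have -> : (k == i) = false by rewrite -val_eqE /=; lia.
    have [kp|//] := ltnP k p.
    have kj : k < j := leq_trans kp pj.
    have gap : ~~ (u i < u k <= v i).
      by apply: contraL kj => gap; rewrite -leqNgt jmin// /P ik.
    lia.
  - rewrite eqxx; lia.
have := le_uv p (v i).+1; lia.
Qed.

Lemma bruhat_le_boxP u v : bruhat_le u v <-> box_le u v.
Proof.
split; first exact: bruhat_le_box_le.
have [m] := ubnP (#|{: 'I_n * 'I_n}| - perm_length u).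
elim: m u => // m IH u; rewrite ltnS => lem le_uv.
have [->|/eqP ne_uv] := eqVneq u v; first exact: connect0.
have [w step_uw le_wv] := box_le_lift le_uv ne_uv.
apply: connect_trans (connect1 step_uw) (IH w _ le_wv).
have lt_len : perm_length u < perm_length w.
  by move/bruhat_stepP: step_uw => [i [j [ij uij ->]]]; exact: perm_length_tperm.
have : perm_length w <= #|{: 'I_n * 'I_n}| by apply: max_card.
lia.
Qed.

End BoxCount.

Local Open Scope classical_set_scope.
Local Open Scope ring_scope.

(** * Masses of boxes *)

Section GammaBox.
Variables (R : realType) (n : nat) (n_gt0 : (0 < n)%N).
Implicit Types (w : 'S_n) (a b : R).

Definition strip (i : nat) a : R :=
  Num.min (i.+1%:R / n%:R) a - Num.min (i%:R / n%:R) a.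

Lemma gamma_box w a b : 0 <= a -> 0 <= b ->
  gamma_measure w (`[0, a] `*` `[0, b]) =
  (n%:R * \sum_(i < n) strip i a * strip (w i) b)%:E.
Proof.
move=> a0 b0; rewrite /gamma_measure mulr_sumr -sumEFin; apply: eq_bigr => i _.
rewrite /grid_square -setXI product_measure1E; last 2 first.
- by apply: measurableI; [exact: measurable_itv|exact: measurable_grid_itv].
- by apply: measurableI; [exact: measurable_itv|exact: measurable_grid_itv].
by rewrite /= !lebesgue_grid_itvI// -!EFinM.
Qed.

Lemma strip_grid (i p : nat) : strip i (p%:R / n%:R) = (i < p)%N%:R / n%:R.
Proof.
have mono (x y : nat) : (x%:R / n%:R <= y%:R / n%:R :> R) = (x <= y)%N.
  by rewrite ler_pM2r ?invr_gt0 ?ltr0n// ler_nat.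
rewrite /strip; case: (ltnP i p) => ip.
  rewrite !min_l ?mono//; last exact: ltnW.
  by rewrite -mulrBl -natr1 addrAC subrr add0r.
by rewrite !min_r ?mono ?subrr ?mul0r// ltnW.
Qed.

(** Minus the second difference of min(x, a) on the grid. *)
Definition strip_drop (p : nat) a : R := strip p a - strip p.+1 a.

(** The function min(x, a) is concave in x. *)
Lemma strip_drop_ge0 p a : 0 <= strip_drop p a.
Proof.
rewrite /strip_drop /strip -[p.+2%:R]natr1 -[p.+1%:R]natr1 !mulrDl mul1r.
have : 0 < n%:R^-1 :> R by rewrite invr_gt0 ltr0n.
move: (n%:R^-1) => h; move: (p%:R * h) => x h0.
by rewrite !minEle; do 3 case: ifPn => ?; lra.
Qed.

(** Abel summation; the boundary term is strip n a, which is zero since the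
    interval of index n lies to the right of 1. *)
Lemma strip_layers (i : 'I_n) a : a <= 1 ->
  strip i a = \sum_(p < n) strip_drop p a * (i < p.+1)%N%:R.
Proof.
move=> a1; under eq_bigr do rewrite mulr_natr mulrb.
have strip_n : strip n a = 0.
  rewrite /strip divff ?pnatr_eq0 -?lt0n// !min_r ?subrr//.
  by rewrite (le_trans a1)// ler_pdivlMr ?ltr0n// mul1r ler_nat leqnSn.
rewrite -big_mkcond/=.
transitivity (strip i a - strip n a); first by rewrite strip_n subr0.
rewrite -opprB.
rewrite -(telescope_sumr (strip^~ a) (ltnW (ltn_ord i))) -sumrN.
rewrite (big_nat_widenl _ 0)// big_mkord.
by apply: eq_big => [p|p _]; rewrite ?ltnS// opprB.
Qed.

Lemma sum_strip_box_count w a b : a <= 1 -> b <= 1 ->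
  \sum_(i < n) strip i a * strip (w i) b =
  \sum_(p < n) \sum_(q < n)
    strip_drop p a * strip_drop q b * (box_count w p.+1 q.+1)%:R.
Proof.
move=> a1 b1.
under eq_bigr do rewrite (strip_layers _ a1) (strip_layers _ b1) big_distrlr/=.
rewrite exchange_big; apply: eq_bigr => p _ /=.
rewrite exchange_big; apply: eq_bigr => q _ /=.
rewrite natr_sum mulr_sumr; apply: eq_bigr => i _.
by rewrite mulrACA -natrM mulnb.
Qed.

Lemma gamma_grid_box w (p q : nat) :
  @gamma_measure R n w (`[0, p%:R / n%:R] `*` `[0, q%:R / n%:R]) =
  ((box_count w p q)%:R / n%:R)%:E.
Proof.
rewrite gamma_box ?divr_ge0//; congr EFin.
have n0 : n%:R != 0 :> R by rewrite pnatr_eq0 -lt0n.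
under eq_bigr do rewrite !strip_grid mulrACA -natrM mulnb.
by rewrite -mulr_suml -natr_sum -/(box_count w p q); field.
Qed.

Lemma permuton_le_boxP u v :
  permuton_le (gamma R n_gt0 u) (gamma R n_gt0 v) <-> box_le u v.
Proof.
split=> [le_uv p q|le_uv a b /andP[a0 a1] /andP[b0 b1]]; last first.
  rewrite /= !(gamma_box _ (ltW a0) (ltW b0)) lee_fin ler_wpM2l//.
  rewrite !(sum_strip_box_count _ (ltW a1) (ltW b1)).
  apply: ler_sum => p _; apply: ler_sum => q _.
  by rewrite ler_wpM2l ?mulr_ge0 ?strip_drop_ge0// ler_nat.
(* The permuton order only speaks of boxes with 0 < a, b < 1; on the degenerate
   boxes all permutations have the same count. *)
have [->|p0] := posnP p; first by rewrite !box_count0l.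
have [->|q0] := posnP q; first by rewrite !box_count0r.
have [np|pn] := leqP n p; first by rewrite !box_count_fulll.
have [nq|qn] := leqP n q; first by rewrite !box_count_fullr.
have inner (k : nat) : (0 < k)%N -> (k < n)%N -> 0 < (k%:R / n%:R : R) < 1.
  move=> k0 kn; rewrite divr_gt0 ?ltr0n//= ltr_pdivrMr ?ltr0n// mul1r.
  by rewrite ltr_nat.
have := le_uv _ _ (inner p p0 pn) (inner q q0 qn).
by rewrite /= !gamma_grid_box lee_fin ler_pM2r ?invr_gt0 ?ltr0n// ler_nat.
Qed.

End GammaBox.

Theorem theorem9p2 (R : realType) (n : nat) (n_gt0 : (0 < n)%N) (u v : 'S_n) :
  permuton_le (gamma R n_gt0 u) (gamma R n_gt0 v) <-> bruhat_le u v.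
Proof.
exact: iff_trans (permuton_le_boxP R n_gt0 u v) (iff_sym (bruhat_le_boxP u v)).
Qed.
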